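(* Let $G$ be a countable infinite discrete group with identity $e$ and let $\mathcal{F}\subset\mathcal{P}(G)$ be a Furstenberg family satisfying (P1) and (P2). For a given $F\in\mathcal{F}$ with $e\in F$, the following assertions are equivalent: (1) there exist a $G$-system $(X,G)$, an $\mathcal{F}$-recurrent point $x\in X$ and a neighborhood $U$ of $x$ such that $N(x,U)\subset F$; (2) there exists a decreasing sequence $\{F_n\}_{n=1}^\infty$ of subsets of $F$ in $\mathcal{F}$ such that for any $n\in\mathbb{N}$ and $f\in F_n$ there exists $m\in\mathbb{N}$ such that $fF_m\subset F_n$.
   Context: $\mathcal{P}(G)$ is the collection of all subsets of $G$ and $\mathcal{P}_f(G)$ the collection of all nonempty finite subsets of $G$. A Furstenberg family is a collection $\mathcal{F}\subset\mathcal{P}(G)\setminus\{\emptyset\}$ such that $F\in\mathcal{F}$ and $F\subset H\subset G$ imply $H\in\mathcal{F}$. $\mathcal{F}$ satisfies (P1) if for any $A\in\mathcal{F}$ there exists a sequence $\{A_n\}_{n=1}^\infty$ in $\mathcal{P}_f(G)$ such that: $A_n\subset A$ for every $n$; $A_n\cap A_m=\emptyset$ for all $n\neq m$; and for every strictly increasing sequence $\{n_k\}_{k=1}^\infty$ in $\mathbb{N}$, $\bigcup_{k=1}^\infty A_{n_k}\in\mathcal{F}$. $\mathcal{F}$ satisfies (P2) if for any $F\in\mathcal{F}$ and any $K\in\mathcal{P}_f(G)$ there exists $F'\subset F$ with $F'\in\mathcal{F}$ such that for any distinct $f_1,f_2\in F'\cup\{e\}$, $Kf_1\cap Kf_2=\emptyset$.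 A $G$-system $(X,G)$ here is a compact metric space $X$ with an action of the discrete group $G$ by homeomorphisms. ''Neighborhood'' means open neighborhood. $N(x,U)=\{g\in G: gx\in U\}$. A point $x\in X$ is $\mathcal{F}$-recurrent if $N(x,U)\in\mathcal{F}$ for every neighborhood $U$ of $x$. *)

(* Defs.v *)
From mathcomp Require Import all_boot.
From mathcomp Require Import all_classical all_reals all_analysis.

Set Implicit Arguments.
Unset Strict Implicit.
Unset Printing Implicit Defensive.

Local Open Scope classical_set_scope.
Local Open Scope group_scope.

Definition furstenberg_family (G : Type) (FF : set (set G)) : Prop :=
  ~ FF set0 /\ (forall A B : set G, FF A -> A `<=` B -> FF B).

Definition nonempty_finite (T : Type) (A : set T) : Prop :=
  A !=set0 /\ finite_set A.

(* Sequences are indexed from 0 here and below. *)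
Definition property_P1 (G : Type) (FF : set (set G)) : Prop :=
  forall A : set G, FF A ->
  exists As : nat -> set G,
    [/\ forall n, nonempty_finite (As n),
        forall n, As n `<=` A,
        forall n m, n <> m -> As n `&` As m = set0
      & forall nk : nat -> nat, {homo nk : i j / (i < j)%N} ->
          FF (\bigcup_k As (nk k))].

Definition left_translate (G : groupType) (f : G) (A : set G) : set G :=
  (fun a => f * a) @` A.

Definition right_translate (G : groupType) (A : set G) (f : G) : set G :=
  (fun a => a * f) @` A.

Definition property_P2 (G : groupType) (FF : set (set G)) : Prop :=
  forall F K : set G, FF F -> nonempty_finite K ->
  exists F' : set G,
    [/\ F' `<=` F,
        FF F'
      & forall f1 f2 : G,
          (F' `|` [set 1]) f1 -> (F' `|` [set 1]) f2 -> f1 <> f2 ->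
          right_translate K f1 `&` right_translate K f2 = set0].

Definition homeomorphism (X Y : topologicalType) (f : X -> Y) : Prop :=
  continuous f /\
  exists g : Y -> X, [/\ cancel f g, cancel g f & continuous g].

Record is_Gsystem (R : realType) (G : groupType) (X : metricType R)
    (act : G -> X -> X) : Prop := {
  Gsystem_compact : compact [set: X] ;
  Gsystem_act1 : forall x, act 1 x = x ;
  Gsystem_actM : forall g h x, act (g * h) x = act g (act h x) ;
  Gsystem_homeo : forall g, homeomorphism (act g)
}.

Definition return_set (G X : Type) (act : G -> X -> X) (x : X) (U : set X)
    : set G :=
  [set g | U (act g x)].

Definition recurrent (G : Type) (X : topologicalType) (act : G -> X -> X)
    (FF : set (set G)) (x : X) : Prop :=
  forall U : set X, open_nbhs x U -> FF (return_set act x U).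

(* Main.v *)
From HB Require Import structures.
Require Import Defs.
From mathcomp Require Import all_boot all_order all_algebra.
From mathcomp Require Import all_classical all_reals all_analysis.

Set Implicit Arguments.
Unset Strict Implicit.
Unset Printing Implicit Defensive.

Import Order.TTheory GRing.Theory Num.Theory.

(** From a recurrent point [x] to the sets: take [Fs n] to be the return times
    of [x] to [U] intersected with the ball of radius [1 / n.+1] around [x].
    If [f x] lies in such an open set, then so does [f y] for every [y] close
    enough to [x], so [f] maps a later set of return times into [Fs n].

    From the sets to a recurrent point: consider the shift of [G] on
    [G -> bool], which is compact and, [G] being countable, metrizable. The
    indicator of a set [A] containing [1] has return times exactly [A] to the
    cylinder [x 1 = true], and it is recurrent as soon as, for each finite set
    [K n] of an exhaustion of [G], the set of those [g] with
    [A (k * g) <-> A k] for all [k] in [K n] belongs to the family. So it is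
    enough to build such an [A] inside [F] ([recurrent_set_exists]).

    For each [n], pick by decreasingness an [Fs m] which every
    [k] in [K n] and [Fs 0] maps into [Fs 0], thin it out by (P2) so that its
    elements [b] have disjoint translates [K n * b], and cut it by (P1) into
    disjoint finite blocks, any infinite subsequence of which has its union in
    the family. Now run through stages [s], each level [n] being visited
    infinitely often, and pick at each stage one block [B] of the visited
    level so far out that the products [K * B] of different stages are
    pairwise disjoint and avoid [1] ([increasing_disjoint_choice]). Let [A] be
    the least set containing [1] and closed under passing from [k] in [A] and
    in the window [K] of a stage to [k * b] for [b] in the block of that stage.
    Disjointness makes the decomposition of an element as such a product
    unique, so that [k * b] is in [A] only if [k] is ([hull_mulE]): every [b]
    in a block of level [n] copies the pattern of [A] on [K n] to [K n * b].
    The blocks chosen for level [n] form a subsequence of those given by (P1),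
    so these [b] make up a member of the family. *)

Local Open Scope classical_set_scope.
Local Open Scope group_scope.

(** * Choosing finite sets far out *)

Section disjoint_choice.
Variable T : choiceType.

Lemma disjoint_seq_eventually_avoids (B : nat -> set T) (E : set T) :
  (forall i j, i <> j -> B i `&` B j = set0) -> finite_set E ->
  exists N, forall j, (N <= j)%N -> B j `&` E = set0.
Proof.
move=> Bdisj /finite_seqP[s ->{E}]; elim: s => [|x s [N IH]].
  by exists 0%N => j _; rewrite set_nil setI0.
have [[i Bix]|nB] := pselect (exists i, B i x); last first.
  exists N => j Nj; apply/seteqP; split=> // y [Bjy] /=.
  rewrite inE => /orP[/eqP yx|ys]; first by apply: nB; exists j; rewrite -yx.
  by have /seteqP[/(_ y) + _] := IH j Nj; apply.
exists (maxn N i.+1) => j; rewrite geq_max => /andP[Nj ij].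
apply/seteqP; split=> // y [Bjy] /=.
rewrite inE => /orP[/eqP yx|ys]; last first.
  by have /seteqP[/(_ y) + _] := IH j Nj; apply.
have ji : i <> j by move=> ji; rewrite ji ltnn in ij.
by have /seteqP[/(_ x) + _] := Bdisj i j ji; apply; split; rewrite // -yx.
Qed.

(** Greedy choice: the indices are picked one after the other, while the union
    of [D0] and of all the sets picked so far, which remains finite, is carried
    along as the set to be avoided. *)
Lemma increasing_disjoint_choice (W : nat -> nat -> set T) (D0 : set T) :
  finite_set D0 -> (forall s j, finite_set (W s j)) ->
  (forall s D, finite_set D ->
     exists N, forall j, (N <= j)%N -> W s j `&` D = set0) ->
  exists js : nat -> nat,
    [/\ {homo js : s t / (s < t)%N},
        forall s, W s (js s) `&` D0 = set0
      & forall s t, s <> t -> W s (js s) `&` W t (js t) = set0].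
Proof.
move=> D0fin Wfin Wavoid.
have [next nextP] : {next : nat -> set T * nat -> nat & forall s p,
    finite_set p.1 -> (p.2 < next s p)%N /\ W s (next s p) `&` p.1 = set0}.
  apply: (@choice _ _ (fun s f => forall p : set T * nat, finite_set p.1 ->
    (p.2 < f p)%N /\ W s (f p) `&` p.1 = set0)) => s.
  suff /choice[f fP] : forall p : set T * nat, exists j, finite_set p.1 ->
      (p.2 < j)%N /\ W s j `&` p.1 = set0 by exists f.
  move=> [D j]; have [Dfin|] := pselect (finite_set D); last by exists 0%N.
  have [N NP] := Wavoid s D Dfin.
  exists (maxn N j.+1) => _ /=; split; first by rewrite leq_maxr.
  by apply: NP; rewrite leq_maxl.
pose st := fix st s := if s is t.+1 then
    ((st t).1 `|` W t (next t (st t)), next t (st t)) else (D0, 0%N).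
have stfin s : finite_set (st s).1.
  by elim: s => //= s IH; rewrite finite_setU.
have stS s t : (s <= t)%N -> (st s).1 `<=` (st t).1.
  elim: t => [|t IH]; first by rewrite leqn0 => /eqP ->.
  rewrite leq_eqVlt ltnS => /orP[/eqP -> //|/IH sub].
  by apply: subset_trans sub _ => x; left.
have Wst s t : (s < t)%N -> W s (st s.+1).2 `<=` (st t).1.
  by move=> st_; apply: subset_trans (stS _ _ st_) => x; right.
have Wdisj s t : (s < t)%N -> W s (st s.+1).2 `&` W t (st t.+1).2 = set0.
  move=> /Wst sub; have [_ W0] := nextP t (st t) (stfin t).
  by apply/seteqP; split=> // x [/sub ? ?]; have /seteqP[/(_ x) + _] := W0; apply.
exists (fun s => (st s.+1).2); split.
- apply: homo_ltn => [? ? ?|s]; first exact: ltn_trans.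
  by have [] := nextP s.+1 (st s.+1) (stfin _).
- move=> s; have [_ W0] := nextP s (st s) (stfin s).
  apply/seteqP; split=> // x [Wx D0x]; have /seteqP[/(_ x) + _] := W0; apply.
  by split => //; apply: (stS 0%N s).
- move=> s t; case: (ltngtP s t) => [/Wdisj //|/Wdisj <- _|//].
  by rewrite setIC.
Qed.

End disjoint_choice.

(** * The set copied by the blocks *)

Section hull.
Variable G : groupType.

(** Each [b] in [B s] is meant to reproduce, on [K s * b], the pattern of the
    hull on the window [K s]. Only the positive half of this is imposed; the
    other half comes from minimality, in [hull_mulE]. *)
Inductive hull (K B : nat -> set G) : G -> Prop :=
| hull_one : hull K B 1
| hull_mul s k b : K s k -> B s b -> hull K B k -> hull K B (k * b).

Definition set_prod (K B : set G) : set G := [set k * b | k in K & b in B].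

(** An element of the hull other than [1] is a product produced at some stage;
    the hypotheses say that the stage and both factors can be read off from the
    product, so [k * b] can only have been produced from [k]. *)
Lemma hull_mulE (K B : nat -> set G) :
  (forall s, ~ set_prod (K s) (B s) 1) ->
  (forall s t, s <> t -> set_prod (K s) (B s) `&` set_prod (K t) (B t) = set0) ->
  (forall s k k' b b', K s k -> K s k' -> B s b -> B s b' ->
     k * b = k' * b' -> b = b') ->
  forall s k b, K s k -> B s b -> hull K B (k * b) <-> hull K B k.
Proof.
move=> W1 Wdisj sep s k b Kk Bb; split; last exact: hull_mul Kk Bb.
move Ekb: (k * b) => g hg; case: hg Ekb => [kb1|t k' b' Kk' Bb' hk' kbE].
  by case: (W1 s); exists k => //; exists b.
have st : s = t.
  apply: contrapT => /Wdisj st0.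
  have : (set_prod (K s) (B s) `&` set_prod (K t) (B t)) (k * b).
    split; first by exists k => //; exists b.
    by rewrite kbE; exists k' => //; exists b'.
  by rewrite st0.
rewrite -{t}st in Kk' Bb'.
have bb' := sep s k k' b b' Kk Kk' Bb Bb' kbE.
by move: kbE; rewrite bb' => /mulIg ->.
Qed.

End hull.

(** * A set recurring along the family *)

Section recurrent_set.
Variables (G : groupType) (FF : set (set G)).
Hypotheses (FF_furstenberg : furstenberg_family FF).
Hypotheses (FF_P1 : property_P1 FF) (FF_P2 : property_P2 FF).

(** (P2) has to be applied before (P1): thinning out the individual blocks
    afterwards would lose the membership of their unions in [FF]. *)
Lemma separated_blocks (F K : set G) : FF F -> nonempty_finite K ->
  exists B : nat -> set G,
    [/\ forall j, B j `<=` F /\ finite_set (B j),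
        forall i j, i <> j -> B i `&` B j = set0,
        forall i k k' b b', K k -> K k' -> B i b -> B i b' ->
          k * b = k' * b' -> b = b'
      & forall js : nat -> nat, {homo js : i j / (i < j)%N} ->
          FF (\bigcup_i B (js i))].
Proof.
move=> FFF Kfin; have [F' [F'F FFF' sep]] := FF_P2 FFF Kfin.
have [B [Bfin BF' Bdisj BFF]] := FF_P1 FFF'.
exists B; split=> //.
  by move=> j; split; [exact: subset_trans (BF' j) F'F | case: (Bfin j)].
move=> i k k' b b' Kk Kk' Bb Bb' kbE; apply: contrapT => bb'.
have /seteqP[/(_ (k * b)) + _] :=
  sep b b' (or_introl (BF' _ _ Bb)) (or_introl (BF' _ _ Bb')) bb'.
by apply; split; [exists k | rewrite kbE; exists k'].
Qed.

Lemma finite_set_prod (K B : set G) :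
  finite_set K -> finite_set B -> finite_set (set_prod K B).
Proof. exact: finite_image2. Qed.

(** [K * B j] meets [D] only if [B j] meets the finite set of all [k^-1 * d]. *)
Lemma set_prod_eventually_avoids (K : set G) (B : nat -> set G) (D : set G) :
  (forall i j, i <> j -> B i `&` B j = set0) -> finite_set K -> finite_set D ->
  exists N, forall j, (N <= j)%N -> set_prod K (B j) `&` D = set0.
Proof.
move=> Bdisj Kfin Dfin.
have Efin : finite_set [set k^-1 * d | k in K & d in D] by exact: finite_image2.
have [N NP] := disjoint_seq_eventually_avoids Bdisj Efin.
exists N => j /NP NE; apply/seteqP; split=> // x [[k Kk [b Bb <-]] Dx].
have /seteqP[/(_ b) + _] := NE; apply; split=> //.
by exists k => //; exists (k * b) => //; rewrite mulKg.
Qed.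

Lemma uniform_translate (F : nat -> set G) (K : set G) :
  (forall n, F n.+1 `<=` F n) -> finite_set K ->
  (forall f, F 0 f -> exists m, left_translate f (F m) `<=` F 0) ->
  exists m, forall k, K k -> F 0 k -> left_translate k (F m) `<=` F 0.
Proof.
move=> Fdecr /finite_seqP[s ->{K}] FM.
have Fle m n : (m <= n)%N -> F n `<=` F m.
  elim: n => [|n IH]; first by rewrite leqn0 => /eqP ->.
  rewrite leq_eqVlt ltnS => /orP[/eqP -> //|/IH sub].
  exact: subset_trans (Fdecr n) sub.
elim: s => [|k s [m IH]]; first by exists 0%N.
have [m' m'P] : exists m', F 0 k -> left_translate k (F m') `<=` F 0.
  have [/FM[m' ?]|] := pselect (F 0 k); first by exists m'.
  by exists 0%N.
exists (maxn m m') => k' /=; rewrite inE => /orP[/eqP ->|ks] Fk'.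
  apply: subset_trans (m'P Fk'); apply: image_subset; apply: Fle.
  exact: leq_maxr.
apply: subset_trans (IH k' ks Fk'); apply: image_subset; apply: Fle.
exact: leq_maxl.
Qed.

(** The blocks and their separation at level [n] depend on [K n] only, not on
    the set under construction; this is what lets all the blocks of one level
    come from a single application of (P1). *)
Lemma recurrent_set_exists (Fs K : nat -> set G) :
  (forall n, FF (Fs n)) -> (forall n, Fs n.+1 `<=` Fs n) ->
  (forall f, Fs 0 f -> exists m, left_translate f (Fs m) `<=` Fs 0) ->
  (forall n, finite_set (K n) /\ K n 1) ->
  exists A : set G,
    [/\ A 1, A `<=` Fs 0 `|` [set 1]
      & forall n, FF [set g | forall k, K n k -> (A (k * g) <-> A k)]].
Proof.
move=> FFFs Fdecr FsM Kfin.
have Fle m : Fs m `<=` Fs 0.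
  by elim: m => // m IH; exact: subset_trans (Fdecr m) IH.
have /choice[B BP] : forall n, exists B : nat -> set G,
    [/\ forall j, finite_set (B j),
        forall i j, i <> j -> B i `&` B j = set0,
        forall i k k' b b', K n k -> K n k' -> B i b -> B i b' ->
          k * b = k' * b' -> b = b',
        forall js : nat -> nat, {homo js : i j / (i < j)%N} ->
          FF (\bigcup_i B (js i))
      & forall j k b, K n k -> (Fs 0 `|` [set 1]) k -> B j b -> Fs 0 (k * b)].
  move=> n; have [Knfin Kn1] := Kfin n.
  have [m mP] := uniform_translate Fdecr Knfin FsM.
  have [B [BF Bdisj Bsep BFF]] :=
    separated_blocks (FFFs m) (conj (ex_intro _ _ Kn1) Knfin).
  exists B; split=> //; first by move=> j; case: (BF j).
  move=> j k b Kk; have BFs := (BF j).1; case=> [Fk|->] Bb.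
    by apply: (mP k Kk Fk); exists b => //; exact: BFs.
  by rewrite mul1g; apply: (Fle m); exact: BFs.
(* Stage s has level the exponent of 2 in s.+1, so that level n is visited
   exactly at the stages 2 ^ n * (2 * i + 1) - 1. *)
pose lev s := logn 2 s.+1.
pose stage n i := (2 ^ n * i.*2.+1).-1.
have stageS n i : (stage n i).+1 = (2 ^ n * i.*2.+1)%N.
  by rewrite prednK// muln_gt0 expn_gt0.
have lev_stage n i : lev (stage n i) = n.
  rewrite /lev stageS lognM ?expn_gt0// pfactorK// lognE dvdn2 /= odd_double.
  by rewrite addn0.
have stage_incr n : {homo stage n : i j / (i < j)%N}.
  by move=> i j ij; rewrite -ltnS !stageS ltn_pmul2l ?expn_gt0// ltnS ltn_double.
have [js [js_incr W1 Wdisj]] : exists js : nat -> nat,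
    [/\ {homo js : s t / (s < t)%N},
        forall s, set_prod (K (lev s)) (B (lev s) (js s)) `&` [set 1] = set0
      & forall s t, s <> t ->
          set_prod (K (lev s)) (B (lev s) (js s)) `&`
          set_prod (K (lev t)) (B (lev t) (js t)) = set0].
  apply: (@increasing_disjoint_choice _
    (fun s j => set_prod (K (lev s)) (B (lev s) j))).
  - exact: finite_set1.
  - move=> s j; apply: finite_set_prod; first by case: (Kfin (lev s)).
    by case: (BP (lev s)).
  - move=> s D Dfin; apply: set_prod_eventually_avoids => //.
      by case: (BP (lev s)).
    by case: (Kfin (lev s)).
pose KK s := K (lev s); pose BB s := B (lev s) (js s).
exists (hull KK BB); split.
- exact: hull_one.
- move=> g; elim=> [|s k b Kk Bb _ Fk]; first by right.
  by left; have [_ _ _ _] := BP (lev s); apply; [exact: Kk|exact: Fk|exact: Bb].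
- move=> n; have [_ FFup] := FF_furstenberg.
  have [_ _ _ BFF _] := BP n.
  apply: FFup (BFF (js \o stage n) _) _.
    by move=> i j ij; apply: js_incr; exact: stage_incr.
  move=> g [i _ Bg] k Kk; apply: (@hull_mulE _ _ _ _ _ _ (stage n i)).
  + move=> s W; have /seteqP[/(_ 1) + _] := W1 s; exact.
  + exact: Wdisj.
  + by move=> s; have [_ _ + _ _] := BP (lev s); exact.
  + by rewrite /KK lev_stage.
  + by rewrite /BB lev_stage.
Qed.

End recurrent_set.

(** * The compact metric space of configurations *)

(** The metric on [T -> bool] depends on an injective numbering of [T] and takes
    its values in [R]; both are parameters of this alias so that instance
    resolution can recover them from the type. *)
Definition config (R : realType) (T : Type) (code : T -> nat)
  (code_inj : injective code) : Type := T -> bool.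

Section config_metric.
Context {R : realType} {T : Type} {code : T -> nat} {code_inj : injective code}.
Local Notation X := (@config R T code code_inj).
Implicit Types x y z : X.

Definition differ_at x y n : bool := `[< exists2 t, code t = n & x t <> y t >].

Definition config_dist x y : R :=
  if pselect (exists n, differ_at x y n) is left h
  then ((ex_minn h).+1%:R^-1)%R else 0%R.

Lemma config_dist_le x y t :
  x t <> y t -> ((code t).+1%:R^-1 <= config_dist x y)%R.
Proof.
move=> xyt; have dt : differ_at x y (code t) by apply/asboolP; exists t.
rewrite /config_dist; case: pselect => [h|[]]; last by exists (code t).
case: ex_minnP => m _ /(_ _ dt) mt.
by rewrite lef_pV2 ?posrE// ler_nat ltnS.
Qed.

Variant config_dist_spec x y : R -> Prop :=
| ConfigEq of x = y : config_dist_spec x y 0%R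
| ConfigNeq t of x t <> y t : config_dist_spec x y ((code t).+1%:R^-1)%R.

Lemma config_distP x y : config_dist_spec x y (config_dist x y).
Proof.
rewrite /config_dist; case: pselect => [h|h].
  by case: ex_minnP => m /asboolP[t <- xyt] _; exact: ConfigNeq.
apply: ConfigEq; apply/funext => t; apply: contrapT => xyt.
by apply: h; exists (code t); apply/asboolP; exists t.
Qed.

Lemma config_dist_ge0 x y : (0 <= config_dist x y)%R.
Proof. by case: config_distP => // t _; rewrite invr_ge0. Qed.

Lemma config_distxx x : config_dist x x = 0%R.
Proof. by case: config_distP. Qed.

Lemma config_dist_eq0 x y : config_dist x y = 0%R -> x = y.
Proof.
by case: config_distP => // t _ /eqP; rewrite invr_eq0 pnatr_eq0.
Qed.

Lemma config_distC x y : config_dist x y = config_dist y x.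
Proof.
apply/eqP; rewrite eq_le; apply/andP; split.
  case: (config_distP x y) => [_|t /nesym]; [exact: config_dist_ge0|].
  exact: config_dist_le.
case: (config_distP y x) => [_|t /nesym]; [exact: config_dist_ge0|].
exact: config_dist_le.
Qed.

Lemma config_dist_triangle y x z :
  (config_dist x z <= config_dist x y + config_dist y z)%R.
Proof.
case: (config_distP x z) => [_|t xzt].
  by rewrite addr_ge0// config_dist_ge0.
have [xyt|xyt] := pselect (x t = y t).
  by rewrite ler_wpDl ?config_dist_ge0// config_dist_le// -xyt.
by rewrite ler_wpDr ?config_dist_ge0// config_dist_le.
Qed.

HB.instance Definition _ := gen_eqMixin X.
HB.instance Definition _ := gen_choiceMixin X.
HB.instance Definition _ := @isMetric.Build R X config_dist
  config_distxx config_dist_eq0 config_distC config_dist_triangle.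

Lemma config_near_coord x t : \forall y \near x, y t = x t.
Proof.
apply/nbhs_ballP; exists ((code t).+1%:R^-1)%R; first by rewrite /= invr_gt0.
move=> y; rewrite ballEmdist /= => xy; apply: contrapT => /nesym /config_dist_le.
by rewrite leNgt => /negP; apply.
Qed.

Lemma config_nbhsP x (U : set X) : nbhs x U ->
  exists n, forall y, (forall t, (code t < n)%N -> y t = x t) -> U y.
Proof.
move=> /nbhs_ballP[e /= e0 xeU].
have [n _ /(_ n (leqnn n)) ne] := near_infty_natSinv_lt (PosNum e0).
exists n.+1 => y yx; apply: xeU; rewrite ballEmdist /=.
change (config_dist x y < e)%R.
case: config_distP => // t xyt; apply: le_lt_trans ne.
rewrite lef_pV2 ?posrE// ler_nat ltnNge.
by apply/negP => tn; apply: xyt; rewrite yx// ltnW.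
Qed.

(** Injectivity of the numbering matters here: a basic neighborhood constrains
    the coordinates numbered below [n], of which there are finitely many. *)
Lemma config_cvg (F : set_system X) {FF : Filter F} x :
  (forall t, \forall y \near F, y t = x t) -> F --> x.
Proof.
move=> Fx U /config_nbhsP[n nU].
suff Fn : \forall y \near F, forall t, (code t < n)%N -> y t = x t.
  by apply: filterS Fn => y; exact: nU.
elim: {nU} n => [|n IH]; first by near=> y.
have [[t tn]|nt] := pselect (exists t, code t = n).
  apply: filterS2 IH (Fx t) => y IH yt t'; rewrite ltnS leq_eqVlt.
  by move=> /orP[/eqP t'n|/IH //]; rewrite (_ : t' = t)//; apply: code_inj; rewrite tn.
apply: filterS IH => y IH t'; rewrite ltnS leq_eqVlt => /orP[/eqP t'n|/IH //].
by case: nt; exists t'.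
Unshelve. all: by end_near. Qed.

(** The identity from the product topology, compact by Tychonoff, to the metric
    topology is continuous. *)
Lemma config_compact : compact [set: X].
Proof.
(* Tychonoff's theorem wants an index set with decidable equality. *)
pose P : topologicalType := prod_topology (fun _ : {classic T} => bool).
have Pcompact : compact [set: P].
  have := @tychonoff {classic T} (fun _ => bool) _ (fun=> bool_compact).
  by congr (compact _); rewrite eqEsubset.
have idC : continuous (fun x : P => x : X).
  move=> x; apply: config_cvg => t.
  apply: (@proj_continuous {classic T} (fun _ => bool) t x [set x t]).
  exact: discrete_set1.
rewrite (_ : [set: X] = (fun x : P => x : X) @` [set: P]).
  apply: continuous_compact => //; exact: continuous_subspaceT.
by apply/seteqP; split=> // x _; exists x.
Qed.

End config_metric.

(** * The shift, and the equivalence *)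

Section shift.
Context {R : realType} {G : groupType} {code : G -> nat}.
Context {code_inj : injective code}.
Local Notation X := (@config R G code code_inj).

(** Translating on the right makes this a left action, and turns the condition
    [A (k * g) <-> A k] into the agreement of [x] and [shift g x] at [k], where
    [x] is the indicator of [A]. *)
Definition shift (g : G) (x : X) : X := fun h => x (h * g).

Lemma shift_continuous g : continuous (shift g).
Proof.
move=> x; apply: (@config_cvg _ _ _ _ _ (fmap_filter _ (nbhs_filter x))) => h.
exact: config_near_coord.
Qed.

Lemma shift_is_Gsystem : is_Gsystem shift.
Proof.
have shift1 x : shift 1 x = x by apply/funext => h; rewrite /shift mulg1.
have shiftM g h x : shift (g * h) x = shift g (shift h x).
  by apply/funext => k; rewrite /shift mulgA.
split=> //; first exact: config_compact.
move=> g; split; first exact: shift_continuous.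
exists (shift g^-1); split; last exact: shift_continuous.
  by move=> x; rewrite -shiftM mulVg.
by move=> x; rewrite -shiftM mulgV.
Qed.

End shift.

(** The return times to a neighborhood base at [x]: continuity of [f] at [x]
    sends a small neighborhood of [x] into any open set containing [f x]. *)
Lemma return_sets_of_recurrent_point (R : realType) (G : groupType)
    (FF : set (set G)) (X : metricType R) (act : G -> X -> X) (x : X)
    (U : set X) :
  is_Gsystem act -> recurrent act FF x -> open_nbhs x U ->
  exists Fs : nat -> set G,
    [/\ forall n, FF (Fs n) /\ Fs n `<=` return_set act x U,
        forall n, Fs n.+1 `<=` Fs n
      & forall n f, Fs n f -> exists m, left_translate f (Fs m) `<=` Fs n].
Proof.
move=> [_ _ actM actH] xrec [Uo Ux].
pose V n : set X := U `&` (ball x (n.+1%:R^-1)%R)°.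
have Vo n : open_nbhs x (V n).
  split; first by apply: openI => //; exact: open_interior.
  by split=> //; apply: nbhsx_ballx; rewrite invr_gt0.
exists (fun n => return_set act x (V n)); split.
- by move=> n; split; [exact: xrec|move=> g []].
- move=> n; apply: preimage_subset; apply: setIS; apply: interiorS.
  by apply: le_ball; rewrite lef_pV2 ?posrE// ler_nat.
- move=> n f Vfx; have [actf _] := actH f.
  have /actf /nbhs_ballP[e /= e0 eV] : nbhs (act f x) (V n).
    by apply: open_nbhs_nbhs; split=> //; case: (Vo n).
  have [m _ /(_ m (leqnn m)) me] := near_infty_natSinv_lt (PosNum e0).
  exists m => _ [g [_ /interior_subset Vgx] <-].
  rewrite /return_set /= actM; apply: eV; apply: le_ball Vgx; exact: ltW.
Qed.

Theorem theorem4p4 (R : realType) (G : groupType)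
    (G_countable : countable [set: G]) (G_infinite : infinite_set [set: G])
    (FF : set (set G)) (FF_furstenberg : furstenberg_family FF)
    (FF_P1 : property_P1 FF) (FF_P2 : property_P2 FF)
    (F : set G) (FF_F : FF F) (F_e : F 1) :
  (exists (X : metricType R) (act : G -> X -> X),
     is_Gsystem act /\
     exists x : X, recurrent act FF x /\
       exists U : set X, open_nbhs x U /\ return_set act x U `<=` F)
  <->
  (exists Fs : nat -> set G,
     [/\ forall n, FF (Fs n) /\ Fs n `<=` F,
         forall n, Fs n.+1 `<=` Fs n
       & forall n f, Fs n f -> exists m, left_translate f (Fs m) `<=` Fs n]).
Proof.
split.
  move=> [X [act [Gsys [x [xrec [U [Uo UF]]]]]]].
  have [Fs [FFs Fdecr FM]] := return_sets_of_recurrent_point Gsys xrec Uo.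
  exists Fs; split=> // n; have [? FU] := FFs n.
  by split=> //; exact: subset_trans FU UF.
move=> [Fs [FFs Fdecr FM]].
have /countable_injP[code codeP] := G_countable.
have code_inj : injective code by move=> g h; apply: codeP; rewrite inE.
pose K n : set G := [set g | (code g < n)%N] `|` [set 1].
have Kfin n : finite_set (K n) /\ K n 1.
  split; last by right.
  rewrite finite_setU; split; last exact: finite_set1.
  apply: (@finite_preimage _ _ (`I_n) code); last exact: finite_II.
  by move=> g h _ _; exact: code_inj.
have [A [A1 AF Arec]] := recurrent_set_exists FF_furstenberg FF_P1 FF_P2
  (fun n => (FFs n).1) Fdecr (FM 0%N) Kfin.
pose x : @config R G code code_inj := fun g => `[< A g >].
exists (@config R G code code_inj), shift; split; first exact: shift_is_Gsystem.
exists x; split.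
  move=> U /open_nbhs_nbhs/config_nbhsP[n nU].
  have [_ FFup] := FF_furstenberg; apply: FFup (Arec n) _ => g gA.
  by apply: nU => k kn; apply: asbool_equiv_eq; apply: gA; left.
(* The return times to this cylinder are the elements of A itself, as
   shift g x evaluates at 1 to x g. *)
exists [set y | y 1 = true]; split.
  split; last exact/asboolP.
  rewrite openE => y /= y1; rewrite /interior.
  by apply: filterS (config_near_coord y 1) => z /= ->.
move=> g; rewrite /return_set /= /shift mul1g => /asboolP/AF[/(FFs 0%N).2 //|->].
exact: F_e.
Qed.
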